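(* Let $(X,S)$ be a finite transformation semigroup, let $d=h_S(X)$ be its height, and let $\mathcal{H}(X,S)=\mathcal{H}_1\wr\cdots\wr\mathcal{H}_d$ be its holonomy wreath product semigroup. Then $(X,S)$ divides its holonomy wreath product: $$(X,S)\mid \mathcal{H}_1\wr\cdots\wr\mathcal{H}_d=\mathcal{H}(X,S).$$
   Context: A (finite) transformation semigroup $(X,S)$ is a finite nonempty set $X$ together with a semigroup $S$ of total maps $X\to X$ closed under composition; maps act on the right, $x\cdot(s_1s_2)=(x\cdot s_1)\cdot s_2$. For $P\subseteq X$, $P\cdot s=\{p\cdot s\mid p\in P\}$. $S^1=S\cup\{1\}$, where $1$ is the identity map of $X$. Division: $(X,S)\mid(Y,T)$ means there exist a subset $Z\subseteq Y$, a subsemigroup $U\le T$ with $z\cdot u\in Z$ for all $z\in Z,u\in U$, a surjective function $\theta_1:Z\to X$ and a surjective semigroup homomorphism $\theta_2:U\to S$ with $\theta_1(z\cdot u)=\theta_1(z)\cdot\theta_2(u)$ for all $z\in Z$, $u\in U$. Wreath product: $(X,S)\wr(Y,T)=(X\times Y,W)$ with $W=\{(s,f)\mid s\in S, f:X\to T\}$, acting by $(x,y)\cdot(s,f)=(x\cdot s,\,y\cdot f(x))$. It is associative up to isomorphism, so it can be iterated; in an iterated wreath product $(X_1,S_1)\wr\cdots\wr(X_n,S_n)$ the $i$th coordinate is acted on by an element of $S_i$ depending only on the coordinates $1,\ldots,i-1$. The empty wreath product (occurring only if $|X|=1$) is the trivial transformation semigroup on one point. Extended image set: $\mathcal{I}'_S(X)=\{X\cdot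 s\mid s\in S\}\cup\{X\}\cup\{\{x\}\mid x\in X\}$. Subduction: for $P,Q\in\mathcal{I}'_S(X)$, $P\subseteq_S Q$ iff $P\subseteq Q\cdot s$ for some $s\in S^1$. This is a preorder; $P\equiv_S Q$ iff $P\subseteq_S Q$ and $Q\subseteq_S P$ (equivalently $P=Q\cdot s$, $Q=P\cdot t$ for some $s,t\in S^1$), and $P\subset_S Q$ iff $P\subseteq_S Q$ and not $Q\subseteq_S P$. Height: for $Q\in\mathcal{I}'_S(X)$, $h_S(Q)=0$ if $Q$ is a singleton; otherwise $h_S(Q)$ is the largest $i$ such that there is a chain $Q_1\subset_S\cdots\subset_S Q_i=Q$ in $\mathcal{I}'_S(X)$ with $|Q_1|>1$. Depth: $d(Q)=h_S(X)-h_S(Q)+1$. Depth is constant on $\equiv_S$-classes. Tiles: for a non-singleton $P\in\mathcal{I}'_S(X)$, a tile of $P$ is a lower cover of $P$ in the poset $(\mathcal{I}'_S(X),\subseteq)$, i.e. a maximal proper subset of $P$ belonging to $\mathcal{I}'_S(X)$; $\mathcal{T}(P)$ is the set of tiles of $P$. Holonomy group: for $P\in\mathcal{I}'_S(X)$ the permutator group $G_P$ is the group of permutations of $P$ obtained by restricting to $P$ the elements $s\in S^1$ with $P\cdot s=P$. For non-singleton $P$, $G_P$ acts on $\mathcal{T}(P)$, and the holonomy group $H_P$ is the permutation group on $\mathcal{T}(P)$ induced by $G_P$ (the action made faithful). Components: choose one representative in each $\equiv_S$-class. For $1\le i\le h_S(X)$ let $R_1,\ldots,R_k$ be the representatives of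 depth $i$. Let $\mathcal{T}_i=\mathcal{T}(R_1)\sqcup\cdots\sqcup\mathcal{T}(R_k)\sqcup\{*\}$ (disjoint union), and let $H_i$ be the group of tuples $(h_1,\ldots,h_k)$ with $h_j\in H_{R_j}$, acting on $\mathcal{T}_i$ by applying $h_j$ to elements of $\mathcal{T}(R_j)$ and fixing $*$. Let $\overline{H_i}$ be $H_i$ together with all constant maps on $\mathcal{T}_i$. Then $\mathcal{H}_i=(\mathcal{T}_i,\overline{H_i})$, and $\mathcal{H}(X,S)=\mathcal{H}_1\wr\cdots\wr\mathcal{H}_d$ with $d=h_S(X)$ is the holonomy wreath product semigroup. *)

(* Defs.v *)
From mathcomp Require Import all_boot all_fingroup.

Set Implicit Arguments.
Unset Strict Implicit.
Unset Printing Implicit Defensive.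

(* Maps act on the right: the product [tcomp s t] applies [s] first. *)
Definition tcomp (X : finType) (s t : {ffun X -> X}) : {ffun X -> X} :=
  [ffun x => t (s x)].

(* An empty set of maps is not excluded; in [divides] the subsemigroup [U] is
   nonempty as soon as [maps A] is. *)
Record tsemi := TSemi {
  point :> finType;
  point_gt0 : 0 < #|point|;
  maps : {set {ffun point -> point}};
  mapsM : {in maps &, forall s t, tcomp s t \in maps}
}.

(* The functions [Z -> A] and [U -> maps A] are given as restrictions of total
   functions; this loses nothing since their codomains can be enlarged to the
   nonempty types [A] and [{ffun A -> A}]. *)
Definition divides (A B : tsemi) : Prop :=
  exists (Z : {set B}) (U : {set {ffun B -> B}})
         (theta1 : B -> A) (theta2 : {ffun B -> B} -> {ffun A -> A}),
    [/\ U \subset maps B,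
        {in U &, forall u v, tcomp u v \in U}
      & forall z u, z \in Z -> u \in U -> u z \in Z] /\
    [/\ theta1 @: Z = [set: A],
        theta2 @: U = maps A,
        {in U &, forall u v, theta2 (tcomp u v) = tcomp (theta2 u) (theta2 v)}
      & forall z u, z \in Z -> u \in U -> theta1 (u z) = theta2 u (theta1 z)].

Section Wreath.

Variables A B : tsemi.

Definition wreath_act (s : {ffun A -> A}) (f : {ffun A -> {ffun B -> B}}) :
    {ffun A * B -> A * B} :=
  [ffun p => (s p.1, f p.1 p.2)].

Definition wreath_maps : {set {ffun A * B -> A * B}} :=
  [set wreath_act s f | s in maps A, f in ffun_on (mem (maps B))].

Fact wreath_gt0 : 0 < #|{: A * B}|.
Proof. by rewrite card_prod muln_gt0 !point_gt0. Qed.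

Fact wreath_mapsM :
  {in wreath_maps &, forall s t, tcomp s t \in wreath_maps}.
Proof.
move=> _ _ /imset2P[s f sA /ffun_onP fB ->] /imset2P[t g tA /ffun_onP gB ->].
apply/imset2P; exists (tcomp s t) [ffun x => tcomp (f x) (g (s x))].
- exact: mapsM.
- by apply/ffun_onP => x; rewrite ffunE; apply: mapsM.
- by apply/ffunP => p; rewrite !ffunE.
Qed.

Definition wreath : tsemi := TSemi wreath_gt0 wreath_mapsM.

End Wreath.

Fact trivial_gt0 : 0 < #|{: unit}|.
Proof. by rewrite card_unit. Qed.

Fact trivial_mapsM :
  {in [set: {ffun unit -> unit}] &, forall s t, tcomp s t \in setT}.
Proof. by move=> s t _ _; rewrite inE. Qed.

Definition trivial_tsemi : tsemi := TSemi trivial_gt0 trivial_mapsM.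

(* Bracketed to the left, so that the last coordinate is acted on by a map
   depending on the tuple of all the previous coordinates. *)
Definition iter_wreath (As : seq tsemi) : tsemi :=
  if As is A :: As' then foldl wreath A As' else trivial_tsemi.

Section Holonomy.

Variable A : tsemi.
Implicit Types (P Q T : {set A}) (s t : {ffun A -> A}).

Definition idmap : {ffun A -> A} := [ffun x => x].

Definition maps1 : {set {ffun A -> A}} := idmap |: maps A.

Definition ext_images : {set {set A}} :=
  [set s @: [set: A] | s : {ffun A -> A} in maps A]
    :|: [set [set: A]] :|: [set [set x] | x : A].

Definition subd P Q : bool :=
  [exists s : {ffun A -> A} in maps1, P \subset s @: Q].

Definition eqd P Q : bool := subd P Q && subd Q P.

Definition ssubd P Q : bool := subd P Q && ~~ subd Q P.

Definition chain Q (c : seq {set A}) : bool :=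
  [&& all (mem ext_images) c, sorted ssubd c, last set0 c == Q
    & 1 < #|head set0 c|].

(* The bound on [n] is no restriction, see [chain_leq_height]. *)
Definition height Q : nat :=
  if #|Q| == 1 then 0
  else \max_(n < #|{set A}|.+1 | [exists c : n.-tuple {set A}, chain Q c]) n.

Definition depth Q : nat := height [set: A] - height Q + 1.

Definition tiles P : {set {set A}} :=
  [set T | maxset (fun Q => (Q \in ext_images) && (Q \proper P)) T].

Definition tile P : finType := {T : {set A} | T \in tiles P}.

(* A permutation of [P] is represented by its extension to [A] by the identity
   outside [P]. *)
Definition permutator P : {set {perm A}} :=
  [set g : {perm A} | perm_on P g
    & [exists s : {ffun A -> A} in maps1,
        (s @: P == P) && [forall x in P, g x == s x]]].

Definition holonomy P : {set {perm tile P}} :=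
  [set h : {perm tile P} |
    [exists g : {perm A} in permutator P,
      [forall T : tile P, val (h T) == g @: val T]]].

Lemma imset_tcomp s t P : tcomp s t @: P = t @: (s @: P).
Proof. by rewrite -imset_comp; apply: eq_imset => x; rewrite ffunE. Qed.

Lemma imset_idmap P : idmap @: P = P.
Proof. by rewrite -[RHS]imset_id; apply: eq_imset => x; rewrite ffunE. Qed.

Lemma maps1M : {in maps1 &, forall s t, tcomp s t \in maps1}.
Proof.
move=> s t /setU1P[-> | sA] /setU1P[-> | tA]; apply/setU1P.
- by left; apply/ffunP => x; rewrite !ffunE.
- by right; suff ->: tcomp idmap t = t by []; apply/ffunP => x; rewrite !ffunE.
- by right; suff ->: tcomp s idmap = s by []; apply/ffunP => x; rewrite !ffunE.
- by right; apply: mapsM.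
Qed.

Lemma subd_refl : reflexive subd.
Proof.
by move=> P; apply/exists_inP; exists idmap; rewrite ?setU11 ?imset_idmap.
Qed.

Lemma subd_trans : transitive subd.
Proof.
move=> Q P R /exists_inP[s sA sPQ] /exists_inP[t tA sQR].
apply/exists_inP; exists (tcomp t s); first exact: maps1M.
by rewrite imset_tcomp (subset_trans sPQ) ?imsetS.
Qed.

Lemma eqd_equiv : {in ext_images & &, equivalence_rel eqd}.
Proof.
move=> P Q R _ _ _; rewrite /eqd subd_refl; split=> // /andP[PQ QP].
by apply/andP/andP => -[PR RP]; split;
  [ apply: subd_trans QP PR | apply: subd_trans RP PQ
  | apply: subd_trans PQ PR | apply: subd_trans RP QP ].
Qed.

Lemma ssubd_trans : transitive ssubd.
Proof.
move=> Q P R /andP[PQ nQP] /andP[QR nRQ]; rewrite /ssubd (subd_trans PQ QR) /=.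
by apply: contra nQP => RP; apply: subd_trans QR RP.
Qed.

Lemma chain_leq_height Q c : #|Q| != 1 -> chain Q c -> size c <= height Q.
Proof.
move=> nQ1 cQ; rewrite /height (negPf nQ1).
have le_c : size c < #|{set A}|.+1.
  rewrite ltnS -(card_uniqP _) ?max_card //.
  case/and4P: cQ => _ /(sorted_uniq ssubd_trans) -> // P.
  by rewrite /ssubd andbN.
by apply: (bigmax_sup (Ordinal le_c)) => //; apply/existsP; exists (in_tuple c).
Qed.

Lemma permutator_group_set P : group_set (permutator P).
Proof.
apply/group_setP; split=> [|g1 g2].
  rewrite inE perm_on1; apply/exists_inP; exists idmap; first exact: setU11.
  rewrite imset_idmap eqxx; apply/forall_inP => x _.
  by rewrite perm1 ffunE.
rewrite !inE => /andP[g1P /exists_inP[s1 s1A /andP[/eqP s1P /forall_inP g1s1]]].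
case/andP=> g2P /exists_inP[s2 s2A /andP[/eqP s2P /forall_inP g2s2]].
rewrite perm_onM //; apply/exists_inP; exists (tcomp s1 s2); first exact: maps1M.
rewrite imset_tcomp s1P s2P eqxx; apply/forall_inP => x Px.
by rewrite permM ffunE (eqP (g1s1 x Px)) g2s2 // -s1P imset_f.
Qed.
Canonical permutator_group P := Group (permutator_group_set P).

Lemma permutator_proper P g Q :
  g \in permutator P -> Q \in ext_images -> Q \proper P ->
  (g @: Q \in ext_images) && (g @: Q \proper P).
Proof.
rewrite inE => /andP[gP /exists_inP[s sA /andP[_ /forall_inP gs]]] QI QP.
have -> : g @: Q = s @: Q.
  by apply: eq_in_imset => x Qx; apply/eqP/gs/(subsetP (proper_sub QP)).
have -> /= : s @: Q \in ext_images.
  move: sA QI; rewrite 2!inE => /predU1P[-> | sA]; first by rewrite imset_idmap.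
  rewrite /ext_images !inE => /orP[/orP[/imsetP[t tA ->] | /eqP ->] | /imsetP[x _ ->]].
  - apply/orP; left; apply/orP; left; apply/imsetP; exists (tcomp t s).
      exact: mapsM.
    by rewrite imset_tcomp.
  - by apply/orP; left; apply/orP; left; apply/imsetP; exists s.
  - by apply/orP; right; apply/imsetP; exists (s x); rewrite ?imset_set1.
have <- : g @: Q = s @: Q.
  by apply: eq_in_imset => x Qx; apply/eqP/gs/(subsetP (proper_sub QP)).
rewrite properEcard card_imset ?proper_card //; last exact: perm_inj.
rewrite andbT; apply/subsetP => _ /imsetP[x Qx ->].
by rewrite (perm_closed x gP) (subsetP (proper_sub QP)).
Qed.

Lemma permutator_tiles P g T :
  g \in permutator P -> T \in tiles P -> g @: T \in tiles P.
Proof.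
move=> gP; rewrite !inE => /maxsetP[/andP[TI TP] maxT].
apply/maxsetP; split=> [|Q /andP[QI QP] sTQ].
  exact: permutator_proper gP TI TP.
have gVP : g^-1%g \in permutator P by rewrite groupV.
have gK (R : {set A}) : g^-1%g @: (g @: R) = R.
  rewrite -imset_comp -[RHS]imset_id.
  by apply: eq_imset => x /=; rewrite permK.
have gVK (R : {set A}) : g @: (g^-1%g @: R) = R.
  rewrite -imset_comp -[RHS]imset_id.
  by apply: eq_imset => x /=; rewrite permKV.
rewrite -(maxT _ (permutator_proper gVP QI QP)) ?gVK //.
by rewrite -{1}(gK T) imsetS.
Qed.

(* Every element of the permutator group does induce a permutation of tiles. *)
Lemma permutator_holonomy P g :
  g \in permutator P ->
  exists2 h, h \in holonomy P & forall T : tile P, val (h T) = g @: val T.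
Proof.
move=> gP; pose f (T : tile P) : tile P :=
  Sub (g @: val T) (permutator_tiles gP (valP T)).
have f_inj : injective f.
  move=> T1 T2 /(congr1 val) /= eqT; apply: val_inj.
  exact: (imset_inj (@perm_inj _ g)) eqT.
have fE (T : tile P) : val (perm f_inj T) = g @: val T by rewrite permE.
exists (perm f_inj) => //; rewrite inE; apply/exists_inP; exists g => //.
by apply/forallP => T; rewrite fE.
Qed.

Lemma holonomy_group_set P : group_set (holonomy P).
Proof.
apply/group_setP; split=> [|h1 h2].
  rewrite inE; apply/exists_inP; exists 1%g; first exact: group1.
  apply/forallP => T; rewrite perm1 -[eqbLHS]imset_id.
  by apply/eqP/eq_imset => x; rewrite perm1.
rewrite !inE => /exists_inP[g1 g1P /forallP h1g1] /exists_inP[g2 g2P /forallP h2g2].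
apply/exists_inP; exists (g1 * g2)%g; first exact: groupM.
apply/forallP => T; rewrite permM (eqP (h2g2 _)) (eqP (h1g1 _)) -imset_comp.
by apply/eqP/eq_imset => x; rewrite /= permM.
Qed.
Canonical holonomy_group P := Group (holonomy_group_set P).

Definition transversal_reps (reps : {set {set A}}) : bool :=
  is_transversal reps (equivalence_partition eqd ext_images) ext_images.

Lemma transversal_reps_exists : exists reps, transversal_reps reps.
Proof.
by eexists; apply/transversalP/equivalence_partitionP/eqd_equiv.
Qed.

Variables (reps : {set {set A}}) (i : nat).

Definition depth_rep : finType :=
  {R : {set A} | (R \in reps) && (depth R == i)}.

(* [None] is the additional point [*]. *)
Definition comp_point : finType :=
  option {R : depth_rep & tile (val R)}.

Definition comp_act (h : {dffun forall R : depth_rep, {perm tile (val R)}}) :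
    {ffun comp_point -> comp_point} :=
  [ffun o => omap (fun u => Tagged (fun R : depth_rep => tile (val R))
                              (h (tag u) (tagged u))) o].

Definition comp_maps : {set {ffun comp_point -> comp_point}} :=
  [set comp_act h | h in family (fun R : depth_rep => mem (holonomy (val R)))]
    :|: [set [ffun=> o] | o : comp_point].

Fact comp_point_gt0 : 0 < #|comp_point|.
Proof. by apply/card_gt0P; exists None. Qed.

Fact comp_mapsM : {in comp_maps &, forall u v, tcomp u v \in comp_maps}.
Proof.
move=> u v /setUP[/imsetP[h /familyP hP ->] | /imsetP[o _ ->]]; last first.
  move=> _; apply/setUP; right; apply/imsetP; exists (v o) => //.
  by apply/ffunP => p; rewrite !ffunE.
case/setUP=> [/imsetP[k /familyP kP ->] | /imsetP[o _ ->]]; apply/setUP.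
  left; apply/imsetP; exists [ffun R : depth_rep => (h R * k R)%g].
    by apply/familyP => R; rewrite ffunE; apply: groupM; [apply: hP | apply: kP].
  by apply/ffunP => -[[R T]|]; rewrite !ffunE //= !ffunE permM.
right; apply/imsetP; exists o => //.
by apply/ffunP => p; rewrite !ffunE.
Qed.

Definition holonomy_comp : tsemi := TSemi comp_point_gt0 comp_mapsM.

End Holonomy.

Definition holonomy_wreath (A : tsemi) (reps : {set {set A}}) : tsemi :=
  iter_wreath [seq holonomy_comp reps i | i <- iota 1 (height [set: A])].

(* Main.v *)
(** Partial information about a point of [A] is recorded by a set of [ext_images]
    containing it. The first [i] coordinates of the wreath product decode to
    such a set [P] of depth greater than [i], and every [s] in [maps A] lifts to
    a map [u] of these coordinates with [s @: P] contained in the set decoded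
    after applying [u]. The next coordinate, if [P] has depth [i.+1], is a tile of
    the representative of [P], and refines [P] to a smaller set. To lift [s] one
    level further, let [Q] be the set decoded after applying [u], of depth
    [i.+1]: if [s @: P = Q] then [P] and [Q] have the same representative, and
    [s] induces an element of its holonomy group; otherwise [s @: P] lies in a
    tile of [Q], and one resets to that tile. After [height A] levels the
    decoded sets are singletons. *)

Require Import Defs.
From mathcomp Require Import all_boot all_fingroup zify.

Set Implicit Arguments.
Unset Strict Implicit.
Unset Printing Implicit Defensive.

(** Since [theta] maps [Z] onto [A], a map [u] lifts at most one [s]. Hence [theta2] is determined
    on the maps that lift something, and it is multiplicative because a composite of lifts lifts the
    composite. *)
Lemma dividesP (A B : tsemi) (Z : {set B}) (theta : B -> A) :
    theta @: Z = [set: A] ->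
    (forall s, s \in maps A -> exists2 u, u \in maps B &
       forall z, z \in Z -> u z \in Z /\ theta (u z) = s (theta z)) ->
  divides A B.
Proof.
move=> theta_onto liftP.
pose lifts (u : {ffun B -> B}) (s : {ffun A -> A}) :=
  [forall z in Z, (u z \in Z) && (theta (u z) == s (theta z))].
pose U := [set u in maps B | [exists s in maps A, lifts u s]].
pose theta2 u := odflt (idmap A) [pick s in maps A | lifts u s].
have lifts_inj u s t : lifts u s -> lifts u t -> s = t.
  move=> us ut; apply/ffunP => x.
  have /imsetP[z zZ ->] : x \in theta @: Z by rewrite theta_onto inE.
  by case/andP: (forall_inP us z zZ) => _ /eqP <-;
    case/andP: (forall_inP ut z zZ) => _ /eqP.
have theta2E u s : s \in maps A -> lifts u s -> theta2 u = s.
  move=> sA us; rewrite /theta2; case: pickP => [t /andP[_ ut]|/(_ s)] /=.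
    exact: lifts_inj ut us.
  by rewrite sA us.
have UP u : u \in U -> [/\ u \in maps B, theta2 u \in maps A & lifts u (theta2 u)].
  by rewrite inE => /andP[uB /exists_inP[s sA us]]; rewrite (theta2E u s).
have liftsM u v s t : lifts u s -> lifts v t -> lifts (tcomp u v) (tcomp s t).
  move=> us vt; apply/forall_inP => z zZ; rewrite !ffunE.
  have /andP[uzZ /eqP <-] := forall_inP us z zZ.
  exact: forall_inP vt _ uzZ.
exists Z, U, theta, theta2; split; split=> //.
- by apply/subsetP => u /UP[].
- move=> u v /UP[uB uA us] /UP[vB vA vt]; rewrite inE mapsM //=.
  apply/exists_inP; exists (tcomp (theta2 u) (theta2 v)); first exact: mapsM.
  exact: liftsM.
- by move=> z u zZ /UP[_ _ /forall_inP/(_ z zZ)/andP[]].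
- apply/setP => s; apply/imsetP/idP => [[u /UP[_ ? _] ->] //|sA].
  have [u uB us] := liftP s sA.
  have lus : lifts u s.
    by apply/forall_inP => z zZ; have [-> ->] := us z zZ; rewrite eqxx.
  exists u; last by rewrite (theta2E u s).
  by rewrite inE uB; apply/exists_inP; exists s.
- move=> u v /UP[uB uA us] /UP[vB vA vt].
  by apply: theta2E; [apply: mapsM|apply: liftsM].
- by move=> z u zZ /UP[_ _ /forall_inP/(_ z zZ)/andP[_ /eqP]].
Qed.

(** * Subduction and monotonicity of the height *)

Section Height.

Variable A : tsemi.
Implicit Types (P Q R T : {set A}) (s t g : {ffun A -> A}).

Lemma maps1_maps s : s \in maps A -> s \in maps1 A.
Proof. exact: setU1r. Qed.

Lemma setT_ext_images : [set: A] \in ext_images A.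
Proof. by rewrite /ext_images !inE eqxx orbT. Qed.

Lemma set1_ext_images (x : A) : [set x] \in ext_images A.
Proof. by rewrite inE imset_f ?orbT. Qed.

Lemma imset_ext_images s P :
  s \in maps1 A -> P \in ext_images A -> s @: P \in ext_images A.
Proof.
move=> sA1; rewrite !inE => /orP[/orP[/imsetP[t tA ->]|/eqP->]|/imsetP[x _ ->]].
- rewrite -imset_tcomp; case/setU1P: sA1 => [->|sA].
    by rewrite imset_tcomp imset_idmap imset_f.
  by rewrite (imset_f (fun s : {ffun A -> A} => s @: [set: A])) ?mapsM.
- case/setU1P: sA1 => [->|sA]; first by rewrite imset_idmap eqxx orbT.
  by rewrite (imset_f (fun s : {ffun A -> A} => s @: [set: A])).
- by rewrite imset_set1 imset_f ?orbT.
Qed.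

Lemma ext_images_gt0 P : P \in ext_images A -> 0 < #|P|.
Proof.
have [x _] := card_gt0P (point_gt0 A).
rewrite card_gt0 !inE => /orP[/orP[/imsetP[t tA ->]|/eqP->]|/imsetP[y _ ->]].
- by apply/set0Pn; exists (t x); rewrite imset_f.
- by apply/set0Pn; exists x.
- by apply/set0Pn; exists y; rewrite inE.
Qed.

Lemma subset_subd P Q : P \subset Q -> subd P Q.
Proof.
by move=> sPQ; apply/exists_inP; exists (idmap A); rewrite ?setU11 ?imset_idmap.
Qed.

Lemma imset_subd s P : s \in maps1 A -> subd (s @: P) P.
Proof. by move=> sA; apply/exists_inP; exists s. Qed.

Lemma subd_card P Q : subd P Q -> #|P| <= #|Q|.
Proof.
by case/exists_inP=> s _ /subset_leq_card/leq_trans-> //; apply: leq_imset_card.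
Qed.

Lemma proper_ssubd P Q : P \proper Q -> ssubd P Q.
Proof.
move=> pPQ; rewrite /ssubd subset_subd ?proper_sub //=.
by apply: contraL (proper_card pPQ) => /subd_card; rewrite -leqNgt.
Qed.

Lemma height_leqP P n :
  (#|P| != 1 -> forall c, chain P c -> size c <= n) -> height P <= n.
Proof.
rewrite /height; case: ifP => // _ cP; apply/bigmax_leqP => k /existsP[c Pc].
by rewrite -(size_tuple c) cP.
Qed.

Lemma height_gt0 P : P \in ext_images A -> (0 < height P) = (#|P| != 1).
Proof.
move=> PI; apply/idP/idP => [|P1]; first by rewrite /height; case: ifP.
apply: (@chain_leq_height _ _ [:: P]) => //.
by rewrite /chain /= PI eqxx ltn_neqAle eq_sym P1 ext_images_gt0.
Qed.

(** A chain ending in [P] remains a chain when [Q] is appended. *)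
Lemma ssubd_height P Q :
  P \in ext_images A -> Q \in ext_images A -> #|Q| != 1 ->
  ssubd P Q -> height P < height Q.
Proof.
move=> PI QI Q1 PQ; rewrite -(ltn_predK (n := height Q) (m := 0)) ?height_gt0 // ltnS.
apply: height_leqP => P1 c /and4P[cI sc /eqP cP c1].
rewrite -ltnS (ltn_predK (m := 0)) ?height_gt0 // -(size_rcons c Q).
apply: chain_leq_height => //; case: c cI sc cP c1 => [|R c] /=.
  (* The empty list is no chain: its head defaults to [set0]. *)
  by move=> _ _ _; rewrite cards0.
move=> cI sc cP R1; rewrite /chain /= all_rcons /= QI last_rcons eqxx R1.
by rewrite rcons_path sc cP PQ; case/andP: cI => -> ->.
Qed.

(** If [P] and [Q] are equivalent, replacing the last set [P] of a chain by [Q] gives a chain of the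
    same length; otherwise the subduction is strict. *)
Lemma subd_height P Q :
  P \in ext_images A -> Q \in ext_images A -> subd P Q -> height P <= height Q.
Proof.
move=> PI QI PQ.
have [P1|P1] := eqVneq #|P| 1; first by rewrite /height P1.
have gt1P : 1 < #|P| by rewrite ltn_neqAle eq_sym P1 ext_images_gt0.
have gt1Q := leq_trans gt1P (subd_card PQ).
have Q1 : #|Q| != 1 by rewrite neq_ltn gt1Q orbT.
have [QP|nQP] := boolP (subd Q P); last first.
  by apply/ltnW/ssubd_height => //; rewrite /ssubd PQ.
apply: height_leqP => _ c /and4P[cI sc /eqP cP c1].
case/lastP: c => [|c R] in cI sc cP c1 *; first by rewrite cards0 in c1.
rewrite last_rcons in cP; rewrite {}cP {R} in cI sc c1 *.
rewrite size_rcons -(size_rcons c Q); apply: chain_leq_height => //.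
rewrite /chain all_rcons last_rcons eqxx /= QI.
rewrite all_rcons in cI; case/andP: cI => _ ->.
case: c sc c1 => [|R c] //=; rewrite !rcons_path => /andP[-> /andP[RP nPR]] -> /=.
rewrite andbT /ssubd (subd_trans RP PQ).
by apply: contra nPR; apply: subd_trans.
Qed.

Lemma height_leT P : P \in ext_images A -> height P <= height [set: A].
Proof.
by move=> PI; rewrite subd_height ?setT_ext_images ?subset_subd ?subsetT.
Qed.

Lemma eqd_height P Q :
  P \in ext_images A -> Q \in ext_images A -> eqd P Q -> height P = height Q.
Proof.
by move=> PI QI /andP[PQ QP]; apply/anti_leq; rewrite !subd_height.
Qed.

(** * Tiles, permutators and class representatives *)

Lemma tile_exists P Q :
  P \in ext_images A -> P \proper Q -> exists T : tile Q, P \subset val T.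
Proof.
move=> PI PQ.
have [|T maxT sPT] := @maxset_exists _ (fun R => (R \in ext_images A) && (R \proper Q)) P.
  by rewrite PI.
have TQ : T \in tiles Q by rewrite inE.
by exists (Sub T TQ); rewrite SubK.
Qed.

Lemma tileP P (T : tile P) : val T \in ext_images A /\ val T \proper P.
Proof. by have := valP T; rewrite inE => /maxsetP[/andP[]]. Qed.

(** A map of the finite set [P] onto itself is injective on it, so extending its restriction by the
    identity yields a permutation of [A]. *)
Lemma permutator_exists g P : g \in maps1 A -> g @: P = P ->
  exists2 p, p \in permutator P & {in P, p =1 g}.
Proof.
move=> gA gP; pose f x := if x \in P then g x else x.
have g_inj : {in P &, injective g} by apply/imset_injP; rewrite gP.
have fP x : (f x \in P) = (x \in P).
  by rewrite /f; case: ifP => // xP; rewrite -{1}gP imset_f.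
have f_inj : injective f.
  move=> x y efxy; have xyP : (x \in P) = (y \in P) by rewrite -fP efxy fP.
  by move: efxy; rewrite /f -xyP; case: ifP => // xP; apply: g_inj; rewrite -?xyP.
have pE : {in P, perm f_inj =1 g} by move=> x xP; rewrite permE /f xP.
exists (perm f_inj) => //; rewrite inE; apply/andP; split.
  apply/subsetP => x; rewrite inE permE /f.
  by case: ifP => //; rewrite eqxx.
apply/exists_inP; exists g; rewrite // gP eqxx.
by apply/forall_inP => x xP; rewrite pE.
Qed.

(** Cardinalities force the subductions to be bijections between [R] and [P]. Their round trip need
    not be the identity of [P], but it is a permutation of [P] whose inverse is also induced by some
    [t] in [maps1]; composing with [t] corrects it. *)
Lemma eqd_maps1 R P : eqd R P ->
  exists e : {ffun A -> A} * {ffun A -> A},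
    [/\ e.1 \in maps1 A, e.2 \in maps1 A, e.1 @: R = P, e.2 @: P = R
      & {in P, cancel e.2 e.1}].
Proof.
case/andP=> RP PR; have eRP : #|R| = #|P| by apply/anti_leq; rewrite !subd_card.
have onto Q Q' : #|Q| = #|Q'| -> subd Q Q' -> exists2 s, s \in maps1 A & s @: Q' = Q.
  move=> eQ /exists_inP[s sA sQ]; exists s => //; apply/esym/eqP.
  by rewrite eqEcard sQ eQ leq_imset_card.
have [f fA fP] := onto _ _ eRP RP; have [e eA eR] := onto _ _ (esym eRP) PR.
have gR : tcomp f e @: P = P by rewrite imset_tcomp fP eR.
have [p pP pE] := permutator_exists (maps1M fA eA) gR.
have /[!inE]/andP[_ /exists_inP[t tA /andP[/eqP tP /forall_inP pt]]] :
  p^-1%g \in permutator P by rewrite groupV.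
exists (e, tcomp t f); split; rewrite ?maps1M //= ?imset_tcomp ?tP // => x xP.
have tx : t x \in P by rewrite -tP imset_f.
by have := pE _ tx; rewrite !ffunE => <-; rewrite -(eqP (pt x xP)) permKV.
Qed.

Lemma rep_exists (reps : {set {set A}}) P :
  transversal_reps reps -> P \in ext_images A -> exists2 R, R \in reps & eqd R P.
Proof.
move=> /and3P[partI sI /forall_inP trI] PI.
have PB : pblock (equivalence_partition (@eqd A) (ext_images A)) P
    \in equivalence_partition (@eqd A) (ext_images A).
  by rewrite pblock_mem // (cover_partition partI).
have /cards1P[R eR] := trI _ PB.
have := set11 R; rewrite -eR => /setIP[Rreps RB].
have RI := subsetP sI R Rreps; exists R => //; move: RB.
by rewrite (pblock_equivalence_partition (@eqd_equiv A)) // /eqd andbC.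
Qed.

(** The choice of [r P] depends only on the predicate [eqd R P] of [R], which equivalent sets share;
    so they receive the same representative, not merely equivalent ones. *)
Lemma rep_system (reps : {set {set A}}) : transversal_reps reps ->
  exists (r : {set A} -> {set A}) (e : {set A} -> {ffun A -> A} * {ffun A -> A}),
  (forall P Q, eqd P Q -> r P = r Q) /\
  (forall P, P \in ext_images A ->
     [/\ r P \in reps, eqd (r P) P, (e P).1 \in maps1 A & (e P).2 \in maps1 A] /\
     [/\ (e P).1 @: r P = P, (e P).2 @: P = r P & {in P, cancel (e P).2 (e P).1}]).
Proof.
move=> tr; pose r P := odflt set0 [pick R in reps | eqd R P].
have rP P : P \in ext_images A -> r P \in reps /\ eqd (r P) P.
  move=> PI; have [R Rr RP] := rep_exists tr PI.
  rewrite /r; case: pickP => [Q /andP[]|/(_ R)] //.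
  by rewrite Rr RP.
have /fin_all_exists[e eP] P : exists e : {ffun A -> A} * {ffun A -> A},
    eqd (r P) P -> [/\ e.1 \in maps1 A, e.2 \in maps1 A, e.1 @: r P = P,
      e.2 @: P = r P & {in P, cancel e.2 e.1}].
  have [/eqd_maps1[e eP]|_] := boolP (eqd (r P) P); first by exists e.
  by exists (idmap A, idmap A).
exists r, e; split=> [P Q PQ|P PI].
  rewrite /r; congr odflt; apply: eq_pick => R; congr andb.
  case/andP: PQ => PQ QP; apply/andP/andP => -[RP PR].
    by rewrite (subd_trans RP PQ) (subd_trans QP PR).
  by rewrite (subd_trans RP QP) (subd_trans PQ PR).
by have [rr rPP] := rP P PI; have [] := eP P rPP.
Qed.

End Height.

(** * Decoding coordinates to sets containing a point *)

Section Approximation.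

Variable A : tsemi.
Implicit Types (P Q T : {set A}) (s : {ffun A -> A}).

(* For sets of [ext_images], [height P + i <= height [set: A]] says that the
   depth of [P] is greater than [i]. *)
Definition approximates (B : tsemi) i : Prop :=
  exists (Z : {set B}) (dec : B -> {set A}),
  [/\ forall z, z \in Z ->
        dec z \in ext_images A /\ height (dec z) + i <= height [set: A],
      forall x, exists2 z, z \in Z & x \in dec z
    & forall s, s \in maps A -> exists2 u, u \in maps B &
        forall z, z \in Z -> u z \in Z /\ s @: dec z \subset dec (u z)].

Lemma approximates_trivial : approximates trivial_tsemi 0.
Proof.
exists setT, (fun=> setT); split=> [z _|x|s _].
- by rewrite setT_ext_images addn0.
- by exists tt.
- by exists [ffun=> tt] => [|z _]; rewrite ?inE ?subsetT.
Qed.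

(** At this level the decoded sets have height 0, so they are singletons, and an inclusion between
    singletons is an equality of points. *)
Lemma approximates_divides (B : tsemi) :
  approximates B (height [set: A]) -> divides A B.
Proof.
case=> Z [dec [decP cov lift]]; have [a _] := card_gt0P (point_gt0 A).
pose theta z := odflt a [pick x in dec z].
have decE z : z \in Z -> dec z = [set theta z].
  move=> zZ; have [dI hz] := decP z zZ.
  have /cards1P[x dx] : #|dec z| == 1.
    by apply: contraTT hz; rewrite -height_gt0 //; lia.
  rewrite /theta; case: pickP => [y|/(_ x)]; rewrite dx inE ?eqxx //.
  by move/eqP ->.
apply: (@dividesP _ _ Z theta) => [|s sA].
  apply/setP => x; rewrite inE; have [z zZ xz] := cov x.
  by move: xz; rewrite decE // => /set1P ->; rewrite imset_f.
have [u uB us] := lift s sA; exists u => // z zZ; have [uz] := us z zZ.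
by rewrite !decE // imset_set1 sub1set => /set1P.
Qed.

(** [iter_wreath] starts at its first component, while the induction starts at the one-point
    semigroup; this removes the extra [unit] coordinate. *)
Lemma approximates_wreath_trivial (C : tsemi) i :
  approximates (wreath trivial_tsemi C) i -> approximates C i.
Proof.
case=> Z [dec [decP cov lift]].
exists [set c : C | (tt, c) \in Z], (fun c => dec (tt, c)).
split=> [c|x|s sA]; first by rewrite inE => /decP.
  by have [[[] c] cZ xc] := cov x; exists c; rewrite ?inE.
have [_ /imset2P[t f _ /ffun_onP fC ->] us] := lift s sA.
exists (f tt) => // c; rewrite !inE => /us; rewrite ffunE /=.
by case: (t tt).
Qed.

Variable reps : {set {set A}}.
Hypothesis reps_tr : transversal_reps reps.

Lemma approximates_step (B : tsemi) i : i < height [set: A] ->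
  approximates B i -> approximates (wreath B (holonomy_comp reps i.+1)) i.+1.
Proof.
move=> lt_i [Z [dec [decP cov lift]]].
have [r [e [r_eqd reP]]] := rep_system reps_tr.
set C := holonomy_comp reps i.+1; pose hX := height [set: A].
(* For [P] of height at most [hX - i], this says that the depth of [P] is exactly [i.+1], so that
   the new coordinate must refine it. *)
pose active P := height P + i == hX.
pose dec1 P (o : C) : {set A} := if active P then
    if o is Some u then (e P).1 @: val (tagged u) else set0 else P.
(* An active set requires a tile of its own representative; at an inactive set every coordinate is
   admissible and [dec1] ignores it. *)
pose ok P (o : C) := active P ==> (if o is Some u then val (tag u) == r P else false).
have active_n1 P : P \in ext_images A -> active P -> #|P| != 1.
  by move=> PI /eqP aP; rewrite -height_gt0 //; rewrite /hX in aP; lia.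
have r_ext P : P \in ext_images A -> r P \in ext_images A.
  by move=> PI; have [[_ _ _ e2] [_ <- _]] := reP P PI; apply: imset_ext_images.
have r_depth P : P \in ext_images A -> active P ->
    (r P \in reps) && (depth (r P) == i.+1).
  move=> PI /eqP aP; have [[-> rPP _ _] _] := reP P PI.
  by rewrite /depth (eqd_height (r_ext P PI) PI rPP); rewrite /hX in aP; lia.
(* Carry [P] into [r Q], where it is a proper subset by cardinality, choose a tile above it, and
   carry that tile back over [P]. *)
have reset P Q : P \in ext_images A -> P \proper Q -> Q \in ext_images A ->
    active Q -> exists o, ok Q o /\ P \subset dec1 Q o.
  move=> PI PQ QI aQ; have [[_ _ _ e2A] [eQ e2Q eK]] := reP Q QI.
  have pR : (e Q).2 @: P \proper r Q.
    rewrite properEcard -{1}e2Q imsetS ?proper_sub //=.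
    apply: leq_ltn_trans (leq_imset_card _ _) (leq_trans (proper_card PQ) _).
    by rewrite -{1}eQ leq_imset_card.
  have [T PT] := tile_exists (imset_ext_images e2A PI) pR.
  pose R : depth_rep reps i.+1 := Sub (r Q) (r_depth Q QI aQ).
  exists (Some (Tagged (fun R : depth_rep reps i.+1 => tile (val R)) (T : tile (val R)))).
  rewrite /ok /dec1 aQ /= eqxx; split=> //; apply/subsetP => x xP.
  rewrite -(eK x (subsetP (proper_sub PQ) x xP)) imset_f //.
  by rewrite (subsetP PT) ?imset_f.
exists [set z : B * C | (z.1 \in Z) && ok (dec z.1) z.2],
  (fun z : B * C => dec1 (dec z.1) z.2).
split=> [[b o]|x|s sA].
- rewrite inE /= => /andP[bZ okb]; have [PI hP] := decP b bZ.
  rewrite /dec1; move: okb; rewrite /ok; case: ifP => [aP|/negbT aP _]; last first.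
    by split=> //; move: aP hP; rewrite /active /hX; lia.
  case: o => //= -[R T] /= /eqP eR; have [TI TR] := tileP T.
  have [[_ _ e1A _] [eP _ _]] := reP _ PI.
  have eTI := imset_ext_images e1A TI; split=> //.
  have pT : (e (dec b)).1 @: val T \proper dec b.
    rewrite properEcard -{2}eP -eR imsetS ?proper_sub //=.
    apply: leq_ltn_trans (leq_imset_card _ _) (leq_trans (proper_card TR) _).
    have [[_ /andP[+ _] _ _] _] := reP _ PI.
    by rewrite -eR => /subd_card.
  (* The strict drop in height pays for the passage from [i] to [i.+1]. *)
  have := ssubd_height eTI PI (active_n1 _ PI aP) (proper_ssubd pT).
  by rewrite addnS -addSn -(leq_add2r i) => /leq_trans->.
- have [b bZ xb] := cov x; have [PI hP] := decP b bZ.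
  have [aP|aP] := boolP (active (dec b)); last first.
    by exists (b, None); rewrite ?inE /= ?bZ /ok /dec1 (negPf aP).
  have [|o [oko xo]] := reset [set x] _ (set1_ext_images x) _ PI aP.
    rewrite properEcard sub1set xb cards1 ltn_neqAle eq_sym.
    by rewrite ext_images_gt0 // active_n1.
  by exists (b, o); rewrite ?inE /= ?bZ //; rewrite sub1set in xo.
have [u uB us] := lift s sA.
(* The action on the new coordinate may depend on [b], as a wreath product allows, but for fixed [b]
   one [v] must serve all admissible [o]. *)
have /fin_all_exists2[f fC fP] b : exists2 v, v \in maps C & b \in Z -> forall o,
    ok (dec b) o -> ok (dec (u b)) (v o) /\
      s @: dec1 (dec b) o \subset dec1 (dec (u b)) (v o).
  have constC (o : C) : [ffun=> o] \in maps C by apply/setUP; right; apply: imset_f.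
  have [bZ|_] := boolP (b \in Z); last by exists [ffun=> None].
  have [ubZ sPQ] := us b bZ; have [PI hP] := decP b bZ; have [QI hQ] := decP _ ubZ.
  move: (dec b) (dec (u b)) => P Q in sPQ PI hP QI hQ *.
  have [[_ rPP e1A e2A] [eP e2P ePK]] := reP P PI.
  have [[_ rQQ f1A f2A] [eQ e2Q eQK]] := reP Q QI.
  have dec1P o : ok P o -> dec1 P o \subset P.
    rewrite /ok /dec1; case: ifP => //= aP; case: o => // -[R T] /= /eqP eR.
    by rewrite -{2}eP imsetS // -eR proper_sub //; case: (tileP T).
  have [aQ|aQ] := boolP (active Q); last first.
    exists [ffun=> None] => // _ o oko; rewrite /ok /(dec1 Q) (negPf aQ); split=> //.
    exact: subset_trans (imsetS _ (dec1P o oko)) sPQ.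
  have [sPeQ|nsPQ] := eqVneq (s @: P) Q; last first.
    have sPQp : s @: P \proper Q by rewrite properEneq nsPQ.
    have [o [oko so]] := reset _ _ (imset_ext_images (maps1_maps sA) PI) sPQp QI aQ.
    exists [ffun=> o] => // _ o' oko'; rewrite ffunE; split=> //.
    exact: subset_trans (imsetS _ (dec1P o' oko')) so.
  (* Now [s @: P] is [Q]. As [Q] is active, [P] cannot be higher than [Q]; so their heights agree,
     and a strict subduction is impossible. *)
  have QP : subd Q P by rewrite -sPeQ imset_subd ?maps1_maps.
  have leQP := subd_height QI PI QP.
  have aP : active P by rewrite /active eqn_leq hP -(eqP aQ) leq_add2r.
  have PQ : eqd P Q.
    have /eqP hPQ : height P == height Q.
      by rewrite -(eqn_add2r i) (eqP aP) eq_sym.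
    rewrite /eqd QP andbT; apply: contraT => nPQ.
    have := ssubd_height QI PI (active_n1 _ PI aP).
    by rewrite hPQ ltnn /ssubd QP nPQ => ->.
  have erPQ := r_eqd _ _ PQ.
  (* From the common representative to [P], by [s] to [Q], and back: this permutes the
     representative. *)
  pose g := tcomp (tcomp (e P).1 s) (e Q).2.
  have gA : g \in maps1 A by do 2!apply: maps1M => //; apply: maps1_maps.
  have gR : g @: r P = r P by rewrite !imset_tcomp eP sPeQ e2Q erPQ.
  have /fin_all_exists2[h hH hE] (R : depth_rep reps i.+1) :
      exists2 k : {perm tile (val R)}, k \in holonomy (val R) &
      val R = r P -> forall T : tile (val R), val (k T) = g @: val T.
    have [eR|/eqP nR] := eqVneq (val R) (r P); last first.
      (* Components at other representatives of this depth are set to the identity. *)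
      by exists 1%g => [|/nR]; rewrite ?group1.
    rewrite -eR in gR; have [p pR pE] := permutator_exists gA gR.
    have [k kH kE] := permutator_holonomy pR; exists k => // _ T.
    rewrite kE; apply: eq_in_imset => x xT; apply: pE.
    by apply: subsetP xT; rewrite proper_sub //; case: (tileP T).
  pose hh : {dffun forall R : depth_rep reps i.+1, {perm tile (val R)}} := finfun h.
  exists (Defs.comp_act hh).
    apply/setUP; left; apply: imset_f; apply/familyP => R.
    by rewrite ffunE; apply: hH.
  move=> _ o; rewrite /ok /dec1 aP aQ /= ffunE; case: o => [[R T]|] //= /eqP eR.
  rewrite -erPQ; split; first exact/eqP.
  rewrite ffunE hE // !imset_tcomp.
  (* [(e Q).1] undoes [(e Q).2] only on [Q], so the image must be located there first. *)
  have sub : s @: ((e P).1 @: val T) \subset Q.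
    by rewrite -sPeQ imsetS // -{2}eP imsetS // -eR proper_sub //; case: (tileP T).
  apply/subsetP => y yT; have yQ := subsetP sub y yT.
  by rewrite -(eQK y yQ) !imset_f.
exists (wreath_act u (finfun f)).
  by apply: imset2_f => //; apply/ffun_onP => b; rewrite ffunE; apply: fC.
move=> [b o]; rewrite !inE /= !ffunE /= => /andP[bZ oko].
have [ubZ _] := us b bZ; rewrite ubZ.
by have [-> ?] := fP b bZ o oko.
Qed.

Lemma approximates_foldl (B : tsemi) i n : i + n <= height [set: A] ->
  approximates B i ->
  approximates (foldl wreath B [seq holonomy_comp reps j | j <- iota i.+1 n]) (i + n).
Proof.
elim: n B i => [|n IHn] B i /=; first by rewrite addn0.
rewrite addnS -addSn => le_in Bi; apply: IHn => //.
by apply: approximates_step => //; apply: leq_trans le_in; apply: leq_addr.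
Qed.

Lemma approximates_holonomy_wreath :
  approximates (holonomy_wreath reps) (height [set: A]).
Proof.
suff {}H n : n <= height [set: A] ->
    approximates (iter_wreath [seq holonomy_comp reps j | j <- iota 1 n]) n.
  exact: H.
(* No levels means the empty wreath product, which is [trivial_tsemi]. *)
case: n => [|n] hn; first exact: approximates_trivial.
rewrite /= -add1n; apply: approximates_foldl => //.
apply: approximates_wreath_trivial; apply: approximates_step.
  exact: leq_trans hn.
exact: approximates_trivial.
Qed.

End Approximation.

Theorem corollary5p10 (A : tsemi) (reps : {set {set A}})
    (reps_tr : transversal_reps reps) :
  divides A (holonomy_wreath reps).
Proof. exact: approximates_divides (approximates_holonomy_wreath reps_tr). Qed.
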